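(* For fixed positive integers $a$ and $b$, $M_r(a;b)$ is log-convex in $r$. That is, $$ M_{2r}(a;b)\,M_{2r+2}(a;b) - M_{2r+1}^2(a;b) > 0. $$
   Context: For positive integers $a$ and $b$, the $k$-th moment $M_k(a;b)$ is defined by $M_k(a;b) = \frac1a\sum_{m=0}^{a-1}\left\lfloor\frac{mb}a\right\rfloor^k$, where $\lfloor x\rfloor$ is the greatest integer not exceeding $x$.
   Formalization: The strict inequality fails for some positive a, b (e.g. a = b = 1); the formal theorem proves non-strict log-convexity for all a, b, and shows the strict inequality holds exactly when a, b ≥ 3, or r = 0 and a, b ≥ 2. *)

(* Defs.v *)
From mathcomp Require Import all_boot all_order all_algebra.
Set Implicit Arguments.
Unset Strict Implicit.
Unset Printing Implicit Defensive.
Import Order.TTheory GRing.Theory Num.Theory.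
Local Open Scope ring_scope.

(* M_k(a;b) as a rational number.  Since x ^+ 0 = 1 for every x, the term
   m = 0 contributes 0^0 = 1 when k = 0, so that M_0(a;b) = 1. *)
Definition moment (k a b : nat) : rat :=
  a%:R^-1 * \sum_(m < a) (Num.floor ((m * b)%N%:R / a%:R : rat))%:~R ^+ k.

Definition log_convex (u : nat -> rat) : Prop :=
  forall k : nat, u k.+1 ^+ 2 <= u k * u k.+2.

(* Main.v *)
Require Import Defs.
From mathcomp Require Import all_boot all_order all_algebra.
From mathcomp Require Import ring zify.
Import Order.TTheory GRing.Theory Num.Theory.
Local Open Scope ring_scope.

(** Up to the factor [a], the moments are the power sums of the natural numbers
    [x_m = (m * b) %/ a] for [m < a].  For any finite family, symmetrizing the
    double sum gives Lagrange's identity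
      2 (s_k s_(k+2) - s_(k+1)^2) = \sum_(i, j) (x_i x_j)^k (x_i - x_j)^2
    ([power_sum_lagrange]).  Every summand is nonnegative when [x >= 0], which
    is log-convexity, and the sum is positive exactly when some summand is
    nonzero: there must be two distinct values, both nonzero if [k > 0]
    ([power_sum_gap_gt0]).

    It remains to see when the values [x_m] differ ([quot_distinct],
    [quot_distinct_neq0]).  They start at [x_0 = 0] and stay below [b], so two
    distinct values require [1 < a] and [1 < b], and two distinct nonzero
    values require [2 < a] and [2 < b].  Conversely these bounds force
    [x_(a-1)] to be at least 1, respectively 2; in the second case, [x] takes
    the value 1 on the way up if [b <= a], and is strictly increasing if
    [a < b]. *)

(** Expanding the square on the left gives three products of power sums; the
    two outer ones agree after exchanging [i] and [j], whence the factor 2. *)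
Lemma power_sum_lagrange (R : comPzRingType) (I : finType) (x : I -> R) k :
  \sum_(p : I * I) (x p.1 * x p.2) ^+ k * (x p.1 - x p.2) ^+ 2 =
  2 * ((\sum_i x i ^+ k) * (\sum_i x i ^+ k.+2) - (\sum_i x i ^+ k.+1) ^+ 2).
Proof.
pose S n m := \sum_i \sum_j x i ^+ n * x j ^+ m.
have SE n m : S n m = (\sum_i x i ^+ n) * (\sum_i x i ^+ m).
  by rewrite big_distrlr.
rewrite -(pair_bigA _ (fun i j => (x i * x j) ^+ k * (x i - x j) ^+ 2)) /=.
transitivity (S k.+2 k + S k k.+2 - 2 * S k.+1 k.+1); last by rewrite !SE; ring.
rewrite /S mulr_sumr -sumrN -!big_split /=; apply: eq_bigr => i _.
rewrite mulr_sumr -sumrN -!big_split /=; apply: eq_bigr => j _.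
by rewrite exprMn !exprS; ring.
Qed.

Lemma power_sum_gap_ge0 (R : realDomainType) (I : finType) (x : I -> R) k :
    (forall i, 0 <= x i) ->
  0 <= (\sum_i x i ^+ k) * (\sum_i x i ^+ k.+2) - (\sum_i x i ^+ k.+1) ^+ 2.
Proof.
move=> x0; rewrite -(pmulr_rge0 _ (ltr0n R 2)) -power_sum_lagrange.
by apply: sumr_ge0 => p _; rewrite mulr_ge0 ?sqr_ge0 ?exprn_ge0 ?mulr_ge0.
Qed.

(** A nonnegative sum is positive when one summand of Lagrange's identity is
    nonzero.  For [k = 0] the factor [(x_i x_j)^k] is 1 even at zero values,
    so these count in that case only. *)
Lemma power_sum_gap_gt0 (R : realDomainType) (I : finType) (x : I -> R) k :
    (forall i, 0 <= x i) ->
  0 < (\sum_i x i ^+ k) * (\sum_i x i ^+ k.+2) - (\sum_i x i ^+ k.+1) ^+ 2 <->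
  exists i j, x i != x j /\ ((0 < k)%N -> x i != 0 /\ x j != 0).
Proof.
move=> x0; rewrite -(pmulr_rgt0 _ (ltr0n R 2)) -power_sum_lagrange.
have F0 p : 0 <= (x p.1 * x p.2) ^+ k * (x p.1 - x p.2) ^+ 2.
  by rewrite mulr_ge0 ?sqr_ge0 ?exprn_ge0 ?mulr_ge0.
rewrite lt0r sumr_ge0 // andbT psumr_neq0 //.
have termE i j : (0 < (x i * x j) ^+ k * (x i - x j) ^+ 2) =
    (x i != x j) && ((0 < k)%N ==> (x i != 0) && (x j != 0)).
  have := F0 (i, j); rewrite /= lt0r => ->.
  rewrite andbT mulf_eq0 !expf_eq0 /= mulf_eq0 subr_eq0 negb_or andbC.
  by rewrite negb_and implybE negb_or.
split=> [/hasP[[i j] _]|[i [j [xij xk]]]].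
  by rewrite /= termE => /andP[xij /implyP xk]; exists i, j; split=> // /xk/andP.
apply/hasP; exists (i, j); first by rewrite mem_index_enum.
by rewrite /= termE xij; apply/implyP => /xk/andP.
Qed.

Lemma quot_distinct a b : (0 < b)%N ->
  (exists i j : 'I_a, (i * b) %/ a <> (j * b) %/ a)%N <->
  (1 < a)%N /\ (1 < b)%N.
Proof.
move=> b0; split=> [[i [j xij]]|[a1 b1]].
  have := ltn_ord i; have := ltn_ord j => ja ia.
  split; last first.
    rewrite ltnNge; apply/negP => b1; apply: xij.
    by rewrite !divn_small //; nia.
  by rewrite ltnNge; apply/negP => a1; apply: xij; congr (_ * _ %/ _)%N; lia.
have a0 : (0 < a)%N by lia.
have lt_last : (a.-1 < a)%N by lia.
exists (Ordinal a0), (Ordinal lt_last) => /=.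
have : (1 <= (a.-1 * b) %/ a)%N by rewrite leq_divRL //; nia.
by rewrite mul0n div0n; case: (_ %/ _)%N.
Qed.

(** The values lie between 0 and [b - 1] and index 0 gives 0, so [2 < a] and
    [2 < b] leave room for two nonzero ones.  For the converse, indices 1 and
    2 serve if [a < b], because then [x] grows by at least 1 at each step; if
    [b <= a], it grows by at most 1, hence takes the value 1 before reaching
    the value [x_(a-1) >= 2]. *)
Lemma quot_distinct_neq0 a b : (0 < b)%N ->
  (exists i j : 'I_a, ((i * b) %/ a <> (j * b) %/ a)%N /\
     ((i * b) %/ a <> 0 /\ (j * b) %/ a <> 0)%N) <->
  (2 < a)%N /\ (2 < b)%N.
Proof.
move=> b0; split=> [[i [j [xij [xi xj]]]]|[a2 b2]].
  have := ltn_ord i; have := ltn_ord j => ja ia.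
  have a0 : (0 < a)%N by lia.
  split; rewrite ltnNge; apply/negP => le2.
    (* A nonzero quotient has a nonzero index, and only index 1 is left. *)
    apply: xij; have [i0 j0] : (i : nat) <> 0%N /\ (j : nat) <> 0%N.
      by split=> m0; [apply: xi | apply: xj]; rewrite m0 mul0n div0n.
    by congr (_ * _ %/ _)%N; lia.
  have lt2 m : (m < a)%N -> ((m * b) %/ a < 2)%N.
    by move=> ma; rewrite ltn_divLR //; nia.
  move: xij xi xj (lt2 _ ia) (lt2 _ ja).
  by move: (i * b %/ a)%N (j * b %/ a)%N; lia.
have a0 : (0 < a)%N by lia.
have [ab|ba] := ltnP a b.
  have lt1 : (1 < a)%N by lia.
  exists (Ordinal lt1), (Ordinal a2) => /=.
  have x1 : (0 < (1 * b) %/ a)%N by rewrite divn_gt0 //; lia.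
  have : ((1 * b) %/ a < (2 * b) %/ a)%N.
    by rewrite leq_divRL // mulSn; have := leq_divM (1 * b) a; nia.
  by lia.
(* The index [(a.-1 %/ b).+1] is the ceiling of [a / b], the first one whose
   quotient is nonzero. *)
pose m := (a.-1 %/ b).+1.
have am : (a <= m * b)%N by have := ltn_ceil a.-1 b0; rewrite -/m; lia.
have ma : (m * b < a + b)%N.
  by have := leq_divM a.-1 b; rewrite /m mulSn; lia.
have lt_m : (m < a)%N by nia.
have lt_last : (a.-1 < a)%N by lia.
exists (Ordinal lt_m), (Ordinal lt_last) => /=.
have x_gt0 : (0 < (m * b) %/ a)%N by rewrite divn_gt0.
have x_lt2 : ((m * b) %/ a < 2)%N by rewrite ltn_divLR //; lia.
have : (2 <= (a.-1 * b) %/ a)%N by rewrite leq_divRL //; nia.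
by lia.
Qed.

Lemma floor_divn (R : archiRealFieldType) (n d : nat) : (0 < d)%N ->
  Num.floor (n%:R / d%:R : R) = (n %/ d)%N%:Z.
Proof.
move=> d0; have dR : 0 < d%:R :> R by rewrite ltr0n.
apply: floor_def; rewrite -PoszD -!pmulrn ler_pdivlMr // ltr_pdivrMr //.
by rewrite -!natrM ler_nat ltr_nat leq_divM addn1 ltn_ceil.
Qed.

Lemma momentE k a b : (0 < a)%N ->
  moment k a b = a%:R^-1 * \sum_(m < a) ((m * b) %/ a)%N%:R ^+ k.
Proof.
by move=> a0; congr (_ * _); apply: eq_bigr => m _; rewrite floor_divn.
Qed.

Lemma moment_gapE k a b : (0 < a)%N ->
  moment k a b * moment k.+2 a b - moment k.+1 a b ^+ 2 =
  a%:R^-1 ^+ 2 * let x (m : 'I_a) : rat := ((m * b) %/ a)%N%:R in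
    ((\sum_i x i ^+ k) * (\sum_i x i ^+ k.+2) - (\sum_i x i ^+ k.+1) ^+ 2).
Proof. by move=> a0; rewrite !momentE //=; ring. Qed.

Theorem theorem12 (a b : nat) (ha : (0 < a)%N) (hb : (0 < b)%N) :
  log_convex (fun k : nat => moment k a b) /\
  (forall r : nat,
     (0 < moment (2 * r) a b * moment (2 * r + 2) a b
          - moment (2 * r + 1) a b ^+ 2)
     <-> ((2 < a)%N /\ (2 < b)%N) \/
         (r = 0%N /\ (1 < a)%N /\ (1 < b)%N)).
Proof.
have a2_gt0 : 0 < a%:R^-1 ^+ 2 :> rat by rewrite exprn_gt0 // invr_gt0 ltr0n.
split=> [k|r].
  rewrite -subr_ge0 moment_gapE // pmulr_rge0 //.
  by apply: power_sum_gap_ge0 => i; rewrite ler0n.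
rewrite addn1 addn2 moment_gapE // pmulr_rgt0 //=.
apply: (iff_trans (power_sum_gap_gt0 _ _ _ _ _)) => [i|]; first by rewrite ler0n.
have [/quot_distinct qd1 /quot_distinct_neq0 qd2] := (hb, hb).
split=> [[i [j []]]|].
  rewrite eqr_nat !pnatr_eq0 => /eqP xij xk.
  have [r0|r0] := posnP r.
    by right; split=> //; apply/qd1; exists i, j.
  left; apply/qd2; exists i, j; split=> //.
  by have [|/eqP xi /eqP xj] := xk; first by rewrite muln_gt0.
case=> [/qd2[i [j [xij [xi xj]]]]|[-> /qd1[i [j xij]]]]; exists i, j.
  by rewrite eqr_nat !pnatr_eq0; split=> [|_]; [|split]; apply/eqP.
by rewrite eqr_nat; split=> //; apply/eqP.
Qed.
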